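(* Let $P\subset\mathbb{R}^n$ be the intersection of an affine subspace of $\mathbb{R}^n$ with the non-negative orthant $\mathbb{R}^n_+$. Suppose $P$ is bounded and contains a point $y=(\eta_1,\dots,\eta_n)$ with $\eta_j>0$ for $j=1,\dots,n$. Then the strictly concave function $$g(x)=\sum_{j=1}^n\Big((\xi_j+1)\ln(\xi_j+1)-\xi_j\ln\xi_j\Big),\qquad x=(\xi_1,\dots,\xi_n),$$ attains its maximum value on $P$ at a unique point $z=(\zeta_1,\dots,\zeta_n)$ with $\zeta_j>0$ for $j=1,\dots,n$. Moreover, if $x_1,\dots,x_n$ are independent geometric random variables with $\mathbf{E}\,x_j=\zeta_j$ and $X=(x_1,\dots,x_n)$, then the probability mass function of $X$ is constant on $P\cap\mathbb{Z}^n$ and equals $e^{-g(z)}$ at every $x\in P\cap\mathbb{Z}^n$. In particular $|P\cap\mathbb{Z}^n|=e^{g(z)}\,\mathbf{Pr}\{X\in P\}$.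
   Context: A geometric random variable with expectation $\zeta>0$ takes value $k\in\{0,1,2,\dots\}$ with probability $pq^k$, where $p=1/(1+\zeta)$ and $q=\zeta/(1+\zeta)$. The convention $0\ln0=0$ is used. *)

(* Defs.v *)
From HB Require Import structures.
From mathcomp Require Import all_boot all_order all_algebra.
From mathcomp Require Import all_classical all_reals all_analysis.

Set Implicit Arguments.
Unset Strict Implicit.
Unset Printing Implicit Defensive.

Import Order.TTheory GRing.Theory Num.Theory.
Import numFieldNormedType.Exports.

Local Open Scope classical_set_scope.
Local Open Scope ring_scope.

Section polyhedron.
Context {R : realType} {n : nat}.
Implicit Types (A : set 'rV[R]_n) (f : 'rV[R]_n -> R) (x y z : 'rV[R]_n).

Definition affine_subspace A : Prop :=
  exists (a : 'rV[R]_n) (V : {vspace 'rV[R]_n}), A = [set x | x - a \in V].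

Definition orthant : set 'rV[R]_n := [set x : 'rV[R]_n | forall j, 0 <= x 0 j].

Definition integer_points : set 'rV[R]_n :=
  [set x : 'rV[R]_n | forall j, x 0 j \is a Num.int].

Definition strictly_concave_on A f : Prop :=
  forall x y (t : R), A x -> A y -> x != y -> 0 < t -> t < 1 ->
    t * f x + (1 - t) * f y < f (t *: x + (1 - t) *: y).

Definition is_maximizer f A z : Prop := A z /\ forall x, A x -> f x <= f z.

(* [ln 0 = 0] in the library, so the convention [0 * ln 0 = 0] holds. *)
Definition entropy x : R :=
  \sum_(j < n) ((x 0 j + 1) * ln (x 0 j + 1) - x 0 j * ln (x 0 j)).

End polyhedron.

Section geometric.
Context {d : measure_display} {T : measurableType d} {R : realType}.
Variable Pr : probability T R.

(* The parameter [zeta] is the expectation of the law; it is determined by the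
   law, so that prescribing ['E_Pr[X]] selects it. *)
Definition geometric_rv (X : {RV Pr >-> nat}) : Prop :=
  exists2 zeta : R, 0 < zeta & forall k : nat,
    Pr (X @^-1` [set k]) =
      ((1 / (1 + zeta)) * (zeta / (1 + zeta)) ^+ k)%:E.

Definition independent_rvs (n : nat) (X : 'I_n -> {RV Pr >-> nat}) : Prop :=
  forall (J : {set 'I_n}) (B : 'I_n -> set nat),
    (forall j, measurable (B j)) ->
    Pr (\bigcap_(j in [set` J]) X j @^-1` B j) =
      (\prod_(j in J) Pr (X j @^-1` B j))%E.

Definition random_vector (n : nat) (X : 'I_n -> {RV Pr >-> nat}) (w : T) :
    'rV[R]_n := \row_j (X j w)%:R.

End geometric.

(* Main.v *)
Require Import Defs.
From HB Require Import structures.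
From mathcomp Require Import all_boot all_order all_algebra.
From mathcomp Require Import finmap.
From mathcomp Require Import ring lra.
From mathcomp Require Import all_classical all_reals all_analysis.
From mathcomp Require Import measurable_realfun.

Set Implicit Arguments.
Unset Strict Implicit.
Unset Printing Implicit Defensive.

Import Order.TTheory GRing.Theory Num.Theory.
Import numFieldNormedType.Exports.

Local Open Scope classical_set_scope.
Local Open Scope ring_scope.

(* With h t = (t + 1) ln (t + 1) - t ln t, Gibbs' inequality places h strictly
   below its tangents, which have slope ln (s + 1) - ln s; hence strict
   concavity, and a unique maximizer z of the entropy on the compact set P.  As
   the slope of h blows up at 0, z is interior to the orthant.  First-order
   optimality then says that the vector of slopes at z is orthogonal to
   x - z for all x in P.  The logarithm of the geometric mass function at x is
   - sum_j (ln (z_j + 1) + x_j (ln (z_j + 1) - ln z_j)), an affine function of x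
   whose linear part is minus this vector of slopes, so on P it takes everywhere
   its value at x = z, which is the negative of the entropy of z. *)

(** * The one-variable entropy: tangents, concavity, continuity *)

Section scalar_entropy.
Context {R : realType}.
Implicit Types s t x y : R.

Lemma ln_lt_subr1 x : 0 < x -> x != 1 -> ln x < x - 1.
Proof.
move=> x0 x1; rewrite ltrBrDl -[ltRHS](lnK x0).
by apply: expR_gt1Dx; rewrite ln_eq0.
Qed.

Lemma ln_le_subr1 x : 0 < x -> ln x <= x - 1.
Proof.
move=> x0; have [->|x1] := eqVneq x 1; first by rewrite ln1 subrr.
exact/ltW/ln_lt_subr1.
Qed.

Definition entropy1 t : R := (t + 1) * ln (t + 1) - t * ln t.

Definition entropy1_slope t : R := ln (t + 1) - ln t.

Lemma entropy10 : entropy1 0 = 0.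
Proof. by rewrite /entropy1 add0r ln1 mul0r mulr0 subrr. Qed.

(** If the factor [t] in front of the slope is replaced by an integer [k], the right side becomes
    minus the logarithm of the mass at [k] of the geometric law with mean [t]. *)
Lemma entropy1_slopeE t :
  entropy1 t = ln (t + 1) + t * entropy1_slope t.
Proof. by rewrite /entropy1 /entropy1_slope; ring. Qed.

(* Divided by [t + 1], this is Gibbs' inequality for the two-point
   distributions with masses [t / (t + 1)] and [s / (s + 1)]. *)
Lemma entropy1_lt_tangent s t : 0 < s -> 0 <= t -> t != s ->
  entropy1 t < entropy1 s + (t - s) * entropy1_slope s.
Proof.
move=> s0; rewrite le_eqVlt => /predU1P[<- _|t0 ts].
  rewrite entropy10 entropy1_slopeE sub0r mulNr addrK.
  by rewrite ln_gt0// ltrDr.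
have s10 : 0 < s + 1 by rewrite addr_gt0.
have t10 : 0 < t + 1 by rewrite addr_gt0.
(* These are the two ratios of masses. With weights [t] and 1 the bounds [ln u <= u - 1] add up to 0
   on the right (equation [e]), and strictness of the first suffices. *)
have a0 : 0 < s * (t + 1) / (t * (s + 1)) by rewrite divr_gt0 ?mulr_gt0.
have b0 : 0 < (t + 1) / (s + 1) by rewrite divr_gt0.
have a1 : s * (t + 1) / (t * (s + 1)) != 1.
  apply: contra_neq ts => /(congr1 ( *%R^~ (t * (s + 1)))).
  rewrite mulfVK ?mul1r ?gt_eqF ?mulr_gt0// => h.
  lra.
have := ln_lt_subr1 a0 a1.
have := ln_le_subr1 b0.
rewrite !ln_div ?posrE ?mulr_gt0// !lnM ?posrE// => hb.
rewrite -(ltr_pM2l t0) => ha.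
have e : t * (s * (t + 1) / (t * (s + 1)) - 1) + ((t + 1) / (s + 1) - 1) = 0.
  by field; rewrite !gt_eqF.
rewrite -subr_gt0 /entropy1 /entropy1_slope.
move: ha hb e.
set A := _ / _; set B := _ / _; move: A B => A B.
move: (ln s) (ln t) (ln (s + 1)) (ln (t + 1)) => a b c d ha hb e.
nra.
Qed.

Lemma entropy1_le_tangent s t : 0 < s -> 0 <= t ->
  entropy1 t <= entropy1 s + (t - s) * entropy1_slope s.
Proof.
move=> s0 t0; have [->|ts] := eqVneq t s.
  by rewrite subrr mul0r addr0.
exact/ltW/entropy1_lt_tangent.
Qed.

(** Both endpoints lie strictly below the tangent at the mean [m], which is positive even if one
    endpoint is 0. In the weighted sum of the two bounds the slope terms cancel. *)
Lemma entropy1_strictly_concave x y t :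
  0 <= x -> 0 <= y -> x != y -> 0 < t -> t < 1 ->
  t * entropy1 x + (1 - t) * entropy1 y < entropy1 (t * x + (1 - t) * y).
Proof.
move=> x0 y0 xy t0 t1; set m := t * x + (1 - t) * y.
have m0 : 0 < m.
  rewrite /m; have [x_gt0|x_le0] := ltP 0 x.
    by rewrite ltr_pwDl ?mulr_gt0// mulr_ge0// subr_ge0 ltW.
  have xE : x = 0 by apply/eqP; rewrite eq_le x_le0.
  rewrite xE mulr0 add0r mulr_gt0 ?subr_gt0// lt_neqAle y0 andbT.
  by rewrite -xE.
have xm : x != m.
  rewrite -subr_eq0 (_ : _ - _ = (1 - t) * (x - y)); last by rewrite /m; ring.
  by apply: mulf_neq0; rewrite subr_eq0// gt_eqF.
have ym : y != m.
  rewrite -subr_eq0 (_ : _ - _ = t * (y - x)); last by rewrite /m; ring.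
  by apply: mulf_neq0; rewrite ?subr_eq0 1?eq_sym// lt_eqF.
have hx := entropy1_lt_tangent m0 x0 xm.
have hy := entropy1_lt_tangent m0 y0 ym.
rewrite -(ltr_pM2l t0) in hx; rewrite -(@ltr_pM2l _ (1 - t)) ?subr_gt0// in hy.
apply: (lt_le_trans (ltrD hx hy)); rewrite le_eqVlt; apply/orP; left.
by apply/eqP; rewrite /m; ring.
Qed.

Lemma entropy1_concave x y t :
  0 <= x -> 0 <= y -> 0 < t -> t < 1 ->
  t * entropy1 x + (1 - t) * entropy1 y <= entropy1 (t * x + (1 - t) * y).
Proof.
move=> x0 y0 t0 t1; have [->|xy] := eqVneq x y.
  by rewrite -!mulrDl addrC subrK !mul1r.
exact/ltW/entropy1_strictly_concave.
Qed.

Lemma entropy1_ge_Nxlnx t : 0 <= t -> - (t * ln t) <= entropy1 t.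
Proof.
move=> t0; rewrite /entropy1 lerDr mulr_ge0// ?addr_ge0// ln_ge0//.
by rewrite lerDr.
Qed.

Lemma entropy1_ge0 t : 0 <= t -> 0 <= entropy1 t.
Proof.
move=> t0; rewrite le_eqVlt in t0; case/predU1P: t0 => [<-|t0].
  by rewrite entropy10.
rewrite entropy1_slopeE addr_ge0//; first by rewrite ln_ge0// lerDr ltW.
rewrite mulr_ge0 ?ltW// /entropy1_slope subr_gt0.
by rewrite ltr_ln ?posrE// ?addr_gt0// ltrDl.
Qed.

(** Comes from [ln u <= u - 1] at the inverse of [Num.sqrt x]. Non-positive [x] are included, where
    [ln x = 0], so that the squeeze at 0 is two-sided. *)
Lemma Nxlnx_le_sqrt x : x < 1 -> 0 <= - (x * ln x) <= 2 * Num.sqrt x.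
Proof.
move=> x1; have [x0|x0] := leP x 0.
  by rewrite ln0// mulr0 oppr0 lexx mulr_ge0.
have s0 : 0 < Num.sqrt x by rewrite sqrtr_gt0.
have xs : x = Num.sqrt x ^+ 2 by rewrite sqr_sqrtr// ltW.
have lx : ln x < 0 by rewrite ln_lt0// x0.
apply/andP; split; first by rewrite -mulrN mulr_ge0 ?ltW// oppr_gt0.
have := ln_le_subr1 (_ : 0 < (Num.sqrt x)^-1).
rewrite invr_gt0 lnV ?posrE// => /(_ s0) h.
rewrite {1 2}xs lnXn// -mulr_natl.
move: (Num.sqrt x) s0 h => s s0; rewrite -(ler_pM2l s0) mulrBr divff ?gt_eqF//.
move: (ln s) => l h.
nra.
Qed.

Lemma continuous_xlnx : continuous (fun x => x * ln x).
Proof.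
move=> x; have [x0|x0|->] := ltgtP x 0.
- have E : \forall y \near x, 0 = y * ln y.
    near=> y; rewrite ln0 ?mulr0// ltW//; near: y.
    exact: lt_nbhsl.
  rewrite /continuous_at ln0 ?mulr0 ?ltW//.
  apply: (cvg_trans (near_eq_cvg E)); exact: cvg_cst.
- by apply: cvgM; [exact: cvg_id|exact: continuous_ln].
have s0 : 2 * Num.sqrt y @[y --> (0 : R)] --> 2 * Num.sqrt (0 : R).
  by apply: cvgM; [exact: cvg_cst|exact: sqrt_continuous].
rewrite sqrtr0 mulr0 in s0.
have n0 : - (y * ln y) @[y --> (0 : R)] --> (0 : R).
  apply: (@squeeze_cvgr _ _ _ _ (cst 0) (fun x => 2 * Num.sqrt x)) => //.
    near=> y; apply: Nxlnx_le_sqrt; near: y.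
    exact: lt_nbhsl.
  exact: cvg_cst.
have := cvgN n0; rewrite oppr0 /continuous_at mul0r.
rewrite (_ : - (fun y => - (y * ln y)) = (fun y => y * ln y)); last first.
  by apply/funext => y; rewrite fctE opprK.
exact.
Unshelve. all: by end_near. Qed.

Lemma continuous_entropy1 : continuous entropy1.
Proof.
move=> x; apply: cvgB; last exact: continuous_xlnx.
apply: (@continuous_comp _ _ _ (fun x => x + 1) (fun x => x * ln x)).
  by apply: cvgD; [exact: cvg_id|exact: cvg_cst].
exact: continuous_xlnx.
Qed.

Lemma continuous_entropy1_slope (t : R) : 0 < t ->
  {for t, continuous entropy1_slope}.
Proof.
move=> t0; have t10 : 0 < t + 1 by rewrite addr_gt0.
have cs : {for t, continuous (@ln R \o (fun x => x + 1))}.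
  apply: continuous_comp; last exact: continuous_ln.
  by apply: cvgD; [exact: cvg_id|exact: cvg_cst].
exact: (cvgB cs (continuous_ln t0)).
Qed.

End scalar_entropy.

(** * The mean of the geometric law *)

Section geometric_law.
Context {R : realType}.
Variable zeta : R.
Hypothesis zeta0 : 0 < zeta.

Let p := 1 / (1 + zeta).
Let q := zeta / (1 + zeta).

(** The subtracted term is the tail from [n] on: its mass is [q ^+ n], and by memorylessness its
    conditional mean is [n%:R + zeta]. *)
Lemma geometric_mean_partial n :
  series (fun k => k%:R * (p * q ^+ k)) n = zeta - q ^+ n * (n%:R + zeta).
Proof.
elim: n => [|n ih]; first by rewrite /series/= big_geq// expr0; ring.
rewrite seriesSr ih exprS -natr1 /p /q.
by move: (_ ^+ n) => c; field; rewrite gt_eqF// addr_gt0.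
Qed.

Lemma geometric_mean_cvg :
  series (fun k => k%:R * (p * q ^+ k)) @ \oo --> zeta.
Proof.
have z10 : 0 < 1 + zeta by rewrite addr_gt0.
have p0 : 0 < p by rewrite divr_gt0.
have q0 : 0 < q by rewrite divr_gt0.
have q1 : q < 1 by rewrite ltr_pdivrMr// mul1r ltrDr.
(* The partial sums are bounded, so the series converges and its general term,
   hence the remainder in the closed form, tends to [0]. *)
have cv : cvgn (series (fun k => k%:R * (p * q ^+ k))).
  apply: nondecreasing_is_cvgn.
    apply/nondecreasing_seqP => n; rewrite seriesSr lerDl.
    by rewrite mulr_ge0// mulr_ge0 ?exprn_ge0 ?ltW.
  exists zeta => _ [n _ <-]; rewrite geometric_mean_partial gerBl.
  by rewrite mulr_ge0 ?exprn_ge0 ?addr_ge0 ?(ltW q0) ?(ltW zeta0).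
have u0 := cvg_series_cvg_0 cv.
have g0 : geometric zeta q @ \oo --> 0.
  by apply: cvg_geometric; rewrite ger0_norm// ltW.
have -> : series (fun k => k%:R * (p * q ^+ k)) =
    (fun n => zeta - (p^-1 * (n%:R * (p * q ^+ n)) + geometric zeta q n)).
  apply/funext => n; rewrite geometric_mean_partial /=; congr (_ - _).
  by field; rewrite gt_eqF.
have := cvgB (cvg_cst zeta) (cvgD (cvgM (cvg_cst p^-1) u0) g0).
by rewrite mulr0 addr0 subr0; exact.
Qed.

(** The integral is split over the level sets of [X]. This ties the parameter hidden in
    [geometric_rv] to the prescribed mean. *)
Lemma expectation_geometric (d : measure_display) (T : measurableType d)
    (Pr : probability T R) (X : {RV Pr >-> nat}) :
  (forall k : nat, Pr (X @^-1` [set k]) = (p * q ^+ k)%:E) ->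
  ('E_Pr[fun w => (X w)%:R] = zeta%:E)%E.
Proof.
move=> PX; rewrite unlock.
have mX k : measurable (X @^-1` [set k]).
  exact: measurable_funPTI.
have TE : [set: T] = \bigcup_k (X @^-1` [set k]).
  by apply/seteqP; split => // w _; exists (X w).
rewrite TE ge0_integral_bigcup//.
- rewrite (eq_eseriesr (g := fun k => (k%:R * (p * q ^+ k))%:E)).
    apply/cvg_lim => //.
    rewrite (_ : (fun n => _) = EFin \o series (fun k => k%:R * (p * q ^+ k))).
      by apply: cvg_EFin; [exact: nearW|exact: geometric_mean_cvg].
    by apply/funext => n /=; rewrite sumEFin.
  move=> k _; rewrite (eq_integral (cst k%:R%:E)); last first.
    by move=> w; rewrite inE/= => ->.
  by rewrite integral_cst// EFinM; congr (_ * _)%E; exact: PX.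
- rewrite -TE.
  have mf : measurable_fun [set: nat] (fun k : nat => (k%:R : R)%:E) by [].
  exact: (measurableT_comp mf (measurable_funPT X)).
- by move=> i j _ _ [w [/= <- <-]].
Qed.

End geometric_law.

(** If [f 0] were non-zero, [f] would keep its sign near 0, and a small [t] of that sign would make
    [t * f t] positive. It stands in for Fermat's rule, with [f] as the derivative along a line. *)
Lemma eq0_of_mul_le0 (R : realType) (f : R -> R) : {for 0, continuous f} ->
  (\forall t \near (0 : R), t * f t <= 0) -> f 0 = 0.
Proof.
move=> cf tf; apply/eqP/negPn/negP; rewrite neq_lt => /orP[f0|f0].
- have ft : \forall t \near (0 : R), f t < 0.
    exact: (@cvgr_lt R R (nbhs (0 : R)) _ f (f 0) cf 0 f0).
  have := filterI tf ft; rewrite -nbhs_ballE => -[e /= e0 he].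
  have [|h1 h2] := he (- (e / 2)).
    by rewrite /ball/= sub0r opprK ger0_norm ?divr_ge0 ?ltW//
      ltr_pdivrMr// mulr_natr mulr2n ltrDr.
  move: h1; rewrite mulNr oppr_le0; apply/negP; rewrite -ltNge.
  by rewrite nmulr_llt0// divr_gt0.
- have ft : \forall t \near (0 : R), f t > 0.
    exact: (@cvgr_gt R R (nbhs (0 : R)) _ f (f 0) cf 0 f0).
  have := filterI tf ft; rewrite -nbhs_ballE => -[e /= e0 he].
  have [|h1 h2] := he (e / 2).
    by rewrite /ball/= sub0r normrN ger0_norm ?divr_ge0 ?ltW//
      ltr_pdivrMr// mulr_natr mulr2n ltrDr.
  move: h1; apply/negP; rewrite -ltNge.
  by rewrite mulr_gt0// divr_gt0.
Qed.

(** * Closed sets in coordinates; continuity and strict concavity of the entropy *)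

Section polyhedron.
Context {R : realType} {n : nat}.
Implicit Types (L P : set 'rV[R]_n) (x y z : 'rV[R]_n).

Lemma cvg_sumr (T I : Type) (F : set_system T) {FF : Filter F} (r : seq I)
    (f : I -> T -> R) (l : I -> R) :
  (forall i, f i u @[u --> F] --> l i) ->
  \sum_(i <- r) f i u @[u --> F] --> \sum_(i <- r) l i.
Proof.
move=> cf; elim: r => [|i r ih].
  rewrite big_nil; under eq_fun do rewrite big_nil.
  exact: cvg_cst.
rewrite big_cons; under eq_fun do rewrite big_cons.
by apply: cvgD; [exact: cf|exact: ih].
Qed.

Lemma continuous_scalar (f : {scalar 'rV[R]_n}) : continuous f.
Proof.
have -> : (f : 'rV[R]_n -> R) = (fun x => \sum_j x 0 j * f (delta_mx 0 j)).
  apply/funext => x; rewrite {1}[x]row_sum_delta linear_sum.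
  by apply: eq_bigr => j _; rewrite linearZ.
move=> x; apply: (@cvg_sumr _ _ (nbhs x) _) => j.
apply: cvgM; last exact: cvg_cst.
exact: coord_continuous.
Qed.

Lemma continuous_entropy : continuous (@entropy R n).
Proof.
move=> x; apply: (@cvg_sumr _ _ (nbhs x) _) => j.
apply: (@continuous_comp _ _ _ (fun x : 'rV[R]_n => x 0 j) entropy1).
  exact: coord_continuous.
exact: continuous_entropy1.
Qed.

Lemma affine_subspace_line L x y (t : R) : affine_subspace L ->
  L x -> L y -> L (x + t *: (y - x)).
Proof.
move=> [a [V ->]] /= xL yL.
rewrite (_ : _ - a = (x - a) + t *: ((y - a) - (x - a))).
  by rewrite rpredD// rpredZ// rpredB.
by rewrite opprB addrA subrK addrAC.
Qed.

(** Membership in [V] means being fixed by [projv V], so [L] is a common zero set of continuous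
    functions. *)
Lemma closed_affine_subspace L : affine_subspace L -> closed L.
Proof.
move=> [a [V ->]].
have -> : [set x | x - a \in V] =
    \bigcap_(j in [set: 'I_n]) [set x | (projv V (x - a) - (x - a)) 0 j = 0].
  apply/seteqP; split => x /= => [xV j _|xV].
    by rewrite /= projv_id// subrr mxE.
  have /eqP <- : projv V (x - a) == x - a.
    rewrite -subr_eq0; apply/eqP/rowP => j; rewrite [RHS]mxE.
    exact: (xV j I).
  exact: memv_proj.
apply: closed_bigI => j _.
have lf : linear_for *%R (fun x => (projv V x - x) 0 j).
  by move=> c u v; rewrite linearP/= !mxE; ring.
pose f0 := GRing.isLinear.Build _ _ _ _ _ lf.
pose f : {scalar 'rV[R]_n} := HB.pack (fun x => (projv V x - x) 0 j) f0.
apply: (@preimage_closed _ _ (fun x => f (x - a)) [set t | t = 0]);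
  last exact: closed_eq.
move=> x _; apply: (@continuous_comp _ _ _ (fun x => x - a) f).
  exact: (@cvgB _ _ _ (nbhs x) _ id (cst a) x a cvg_id (cvg_cst a)).
exact: continuous_scalar.
Qed.

Lemma closed_orthant : closed (@orthant R n).
Proof.
have -> : @orthant R n = \bigcap_(j in [set: 'I_n]) [set x | 0 <= x 0 j].
  by apply/seteqP; split => x /= h j => [_|]; exact: h.
apply: closed_bigI => j _.
apply: (@preimage_closed _ _ (fun x : 'rV[R]_n => x 0 j) [set t | 0 <= t]).
  by move=> x _; exact: coord_continuous.
exact: closed_ge.
Qed.

(** Distinct points differ in some coordinate [j]. Strictness there suffices, with weak concavity in
    the others. *)
Lemma entropy_strictly_concave : strictly_concave_on orthant (@entropy R n).
Proof.
move=> x y t x0 y0 xy t0 t1.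
have [j xyj] : exists j, x 0 j != y 0 j.
  apply/existsP; apply: contra_neqT xy => /existsPn h.
  by apply/rowP => j; apply/eqP; have := h j; rewrite negbK.
rewrite /entropy !mulr_sumr -big_split/= (bigD1 j)//= [ltRHS](bigD1 j)//=.
apply: ltr_leD; first by rewrite !mxE; exact: entropy1_strictly_concave.
by apply: ler_sum => i _; rewrite !mxE; exact: entropy1_concave.
Qed.

End polyhedron.

(** * The maximizer: existence, uniqueness, positivity, first-order condition *)

Section maximizer.
Context {R : realType} {n : nat}.
Variables L P : set 'rV[R]_n.
Hypotheses (affL : affine_subspace L) (PE : P = L `&` orthant).

Lemma polyhedron_segment x y (t : R) : P x -> P y -> 0 < t -> t < 1 ->
  P (t *: x + (1 - t) *: y).
Proof.
rewrite PE => -[xL x0] [yL y0] t0 t1; split.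
  rewrite (_ : _ + _ = y + t *: (x - y)); first exact: affine_subspace_line.
  by apply/rowP => j; rewrite !mxE; ring.
by move=> j; rewrite !mxE addr_ge0// mulr_ge0// ltW// subr_gt0.
Qed.

Lemma entropy_maximizer_exists : bounded_set P -> P !=set0 ->
  exists z, is_maximizer entropy P z.
Proof.
move=> bP P0.
have cP : compact P.
  apply: bounded_closed_compact => //; rewrite PE; apply: closedI.
    exact: closed_affine_subspace.
  exact: closed_orthant.
have [z zP zmax] : exists2 z, z \in P &
    forall x, x \in P -> entropy x <= entropy z.
  apply: EVT_max_rV => //; apply: continuous_subspaceT.
  exact: continuous_entropy.
exists z; split; first by rewrite inE in zP.
by move=> x xP; apply: zmax; rewrite inE.
Qed.

(** The midpoint of two distinct maximizers would have larger entropy. *)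
Lemma entropy_maximizer_unique z z' :
  is_maximizer entropy P z -> is_maximizer entropy P z' -> z' = z.
Proof.
move=> [zP zmax] [zP' zmax']; apply/eqP/negPn/negP => zz'.
have h0 : 0 < 2^-1 :> R by rewrite invr_gt0.
have h1 : 2^-1 < 1 :> R by rewrite invf_lt1// ltr1n.
have mP := polyhedron_segment zP' zP h0 h1.
have [zo zo'] : orthant z /\ orthant z'.
  by move: zP zP'; rewrite PE => -[_ ?] [_ ?].
have := entropy_strictly_concave zo' zo zz' h0 h1.
have := zmax _ mP; have := zmax' _ zP.
move: (entropy z) (entropy z') (entropy _) => a b c.
lra.
Qed.

(* Near a boundary point with [z 0 j = 0], moving by [t] towards [y] gains at
   least [- t y_j ln (t y_j)] while concavity bounds the loss by
   [t * entropy z]. *)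
Lemma entropy_maximizer_gt0 z y : is_maximizer entropy P z ->
  P y -> (forall j, 0 < y 0 j) -> forall j, 0 < z 0 j.
Proof.
move=> [zP zmax] yP y0 j.
have z0 : orthant z by move: zP; rewrite PE => -[].
have yj0 := y0 j.
rewrite lt_neqAle (z0 j) andbT; apply/negP => /eqP zj0.
(* With [t * y 0 j <= e], minus the logarithm of [t * y 0 j] is at least [entropy z / y 0 j + 1], so
   the gain exceeds [t * entropy z]. *)
pose e := expR (- entropy z / y 0 j - 1).
have e0 : 0 < e by rewrite expR_gt0.
pose t := Num.min 2^-1 (e / y 0 j).
have t0 : 0 < t by rewrite lt_min invr_gt0 ltr0n divr_gt0.
have t1 : t < 1 by rewrite gt_min invf_lt1// ltr1n.
have ty : t * y 0 j <= e by rewrite -ler_pdivlMr// ge_min lexx orbT.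
have ty0 : 0 < t * y 0 j by rewrite mulr_gt0.
have lty : ln (t * y 0 j) <= - entropy z / y 0 j - 1.
  by rewrite -[leRHS]expRK ler_ln ?posrE.
have := zmax _ (polyhedron_segment yP zP t0 t1).
apply/negP; rewrite -ltNge.
have sE : entropy z = \sum_(i | i != j) entropy1 (z 0 i).
  by rewrite /entropy (bigD1 j)//= -/(entropy1 _) -zj0 entropy10 add0r.
have gain : t * entropy z < entropy1 (t * y 0 j).
  apply: lt_le_trans (entropy1_ge_Nxlnx (ltW ty0)).
  rewrite -subr_gt0 (_ : _ - _ =
    t * y 0 j * (- entropy z / y 0 j - ln (t * y 0 j))).
    by rewrite mulr_gt0// subr_gt0 (le_lt_trans lty)// ltrBlDr ltrDl.
  by field; rewrite gt_eqF.
rewrite [ltRHS]/entropy (bigD1 j)//= -/(entropy1 _) !mxE -zj0 mulr0 addr0.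
(* [entropy z] is split with weights [t] and [1 - t]. [gain] covers the first part; in the
   coordinates other than [j], concavity with the non-negative terms at [y] dropped covers the
   second. *)
rewrite -[ltLHS]mul1r -[X in X * _](subrK t) mulrDl addrC.
apply: ler_ltD => //; rewrite sE mulr_sumr; apply: ler_sum => i _.
rewrite -/(entropy1 _) !mxE.
apply: le_trans (entropy1_concave (ltW (y0 i)) (z0 i) t0 t1).
by rewrite lerDr mulr_ge0 ?entropy1_ge0// ltW.
Qed.

(* First-order optimality; the tangent inequality at [z + t (x - z)] replaces
   the differentiation of the entropy. *)
Lemma entropy_maximizer_orthogonal z : is_maximizer entropy P z ->
  (forall j, 0 < z 0 j) -> forall x, P x ->
  \sum_j (x 0 j - z 0 j) * entropy1_slope (z 0 j) = 0.
Proof.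
move=> [zP zmax] z0 x xP.
pose m (t : R) j := z 0 j + t * (x 0 j - z 0 j).
have cm j : continuous (m ^~ j).
  move=> t; apply: cvgD; first exact: cvg_cst.
  by apply: cvgM; [exact: cvg_id|exact: cvg_cst].
have m0 j : m 0 j = z 0 j by rewrite /m mul0r addr0.
pose f t := \sum_j (x 0 j - z 0 j) * entropy1_slope (m t j).
suff : f 0 = 0 by rewrite /f; under eq_bigr do rewrite m0.
apply: eq0_of_mul_le0.
  apply: (@cvg_sumr _ _ _ (nbhs (0 : R)) _) => j.
  apply: cvgM; first exact: cvg_cst.
  apply: (@continuous_comp _ _ _ (m ^~ j) (@entropy1_slope R)).
    exact: cm.
  by apply: continuous_entropy1_slope; rewrite m0.
(* Here [t] has either sign: since [z] is positive, the line stays in the orthant on both sides of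
   0, which gives an equality. *)
near=> t.
have mt0 : forall j, 0 < m t j.
  near: t; apply: filter_forall => j.
  by apply: (cvgr_gt (m 0 j)); [exact: cm|rewrite m0].
have mP : P (z + t *: (x - z)).
  move: xP zP; rewrite PE => -[xL _] [zL _]; split.
    exact: affine_subspace_line.
  by move=> j; rewrite !mxE; apply/ltW/mt0.
have h1 := zmax _ mP.
(* Tangents at the moved point are evaluated at [z]. As [z 0 j - m t j] is [- t * (x 0 j - z 0 j)],
   maximality of [z] leaves [t * f t <= 0]. *)
have h2 : entropy z <=
    \sum_j (entropy1 (m t j) + (z 0 j - m t j) * entropy1_slope (m t j)).
  by apply: ler_sum => j _; apply: entropy1_le_tangent => //; exact: ltW.
have E : entropy (z + t *: (x - z)) = \sum_j entropy1 (m t j).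
  by apply: eq_bigr => j _; rewrite !mxE.
rewrite -oppr_ge0; move: h2; rewrite big_split/= -E => h2.
have : 0 <= \sum_j (z 0 j - m t j) * entropy1_slope (m t j).
  by rewrite -(lerD2l (entropy (z + t *: (x - z)))) addr0 (le_trans h1).
congr (0 <= _); rewrite /f mulr_sumr -sumrN; apply: eq_bigr => j _.
by rewrite /m; ring.
Unshelve. all: by end_near. Qed.

End maximizer.

(** * Integer points and the law of the random vector *)

Section lattice_points.
Context {R : realType} {n : nat}.
Implicit Types (P : set 'rV[R]_n) (x z : 'rV[R]_n).

Lemma le_coord_norm x j : `|x 0 j| <= `|x|.
Proof.
rewrite [leRHS]/Num.norm/= mx_normrE; apply/bigmax_geP; right => /=.
by exists (0, j).
Qed.

Lemma nonneg_integer_pointE x : orthant x -> integer_points x ->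
  x = \row_j (Num.truncn (x 0 j))%:R.
Proof.
move=> x0 xZ; apply/rowP => j; rewrite mxE truncnK//.
by rewrite -intrEge0 ?x0//; exact: xZ.
Qed.

Lemma finite_integer_points P : P `<=` orthant -> bounded_set P ->
  finite_set (P `&` integer_points).
Proof.
move=> P0 [M [Mreal hM]].
(* [bounded_set] bounds the norm only by reals strictly above [M], hence [M + 1]; the successor
   makes the truncations elements of ['I_N]. *)
pose N := (Num.truncn (M + 1)).+1.
pose f (k : {ffun 'I_n -> 'I_N}) : 'rV[R]_n := \row_j (k j)%:R.
apply: (@sub_finite_set _ _ (f @` setT)); last exact/finite_image/finite_finset.
move=> x [xP xZ]; have x0 := P0 _ xP.
have lt_N j : (Num.truncn (x 0%R j) < N)%N.
  rewrite ltnS; apply: le_truncn; apply: le_trans (ler_norm _) _.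
  apply: le_trans (le_coord_norm _ _) _.
  by apply: (hM (M + 1)) => //; rewrite ltrDl.
exists [ffun j => Ordinal (lt_N j)] => //.
rewrite [RHS]nonneg_integer_pointE//; apply/rowP => j.
by rewrite !mxE ffunE.
Qed.

Lemma geometric_pmfE (zeta : R) (k : nat) : 0 < zeta ->
  1 / (1 + zeta) * (zeta / (1 + zeta)) ^+ k =
    expR (- (ln (zeta + 1) + k%:R * entropy1_slope zeta)).
Proof.
move=> z0; have z10 : 0 < zeta + 1 by rewrite addr_gt0.
rewrite opprD expRD expRN lnK ?posrE// -mulrN expRM_natl div1r addrC.
by rewrite opprB expRB !lnK ?posrE.
Qed.

Lemma entropyE z :
  entropy z = \sum_j (ln (z 0 j + 1) + z 0 j * entropy1_slope (z 0 j)).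
Proof. by apply: eq_bigr => j _; rewrite -entropy1_slopeE. Qed.

Section law.
Context {d : measure_display} {T : measurableType d} {Pr : probability T R}.
Variables (X : 'I_n -> {RV Pr >-> nat}) (z : 'rV[R]_n).
Hypotheses (indepX : independent_rvs X) (geomX : forall j, geometric_rv (X j))
  (EX : forall j, ('E_Pr[fun w => (X j w)%:R] = (z 0 j)%:E)%E).

Lemma random_vector_preimage (k : 'I_n -> nat) :
  random_vector X @^-1` [set \row_j (k j)%:R : 'rV[R]_n] =
    \bigcap_(j in [set` [set: 'I_n]%SET]) X j @^-1` [set k j].
Proof.
apply/seteqP; split => w /= h.
  move=> j _ /=; have /rowP/(_ j) := h; rewrite !mxE => /eqP.
  by rewrite eqr_nat => /eqP.
by apply/rowP => j; rewrite !mxE (h j)//= inE.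
Qed.

Lemma measurable_random_vector (k : 'I_n -> nat) :
  measurable (random_vector X @^-1` [set \row_j (k j)%:R : 'rV[R]_n]).
Proof.
rewrite random_vector_preimage; apply: fin_bigcap_measurable => // j _.
exact: measurable_funPTI.
Qed.

(** The hypothesis is the first-order condition at the point [k]. By independence the mass is a
    product whose logarithm depends on [k] only through the left sum. *)
Lemma random_vector_pmf (k : 'I_n -> nat) :
  \sum_j (k j)%:R * entropy1_slope (z 0 j) =
    \sum_j z 0 j * entropy1_slope (z 0 j) ->
  Pr (random_vector X @^-1` [set \row_j (k j)%:R]) = (expR (- entropy z))%:E.
Proof.
move=> hk; rewrite random_vector_preimage indepX// (eq_bigl xpredT);
  last by move=> j; rewrite inE.
rewrite (eq_bigr (fun j => (expR (- (ln (z 0 j + 1) +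
    (k j)%:R * entropy1_slope (z 0 j))))%:E)); last first.
  move=> j _; have [zeta zeta0 XE] := geomX j.
  have zE : zeta = z 0 j.
    by apply: EFin_inj; rewrite -EX (expectation_geometric zeta0 XE).
  by rewrite XE geometric_pmfE// zE.
by rewrite prodEFin -expR_sum sumrN entropyE !big_split/= -hk.
Qed.

(** The vector takes only integer values, so the event is a finite disjoint union of fibres of equal
    mass. *)
Lemma prob_random_vector_count P (c : R) :
  P `<=` orthant -> finite_set (P `&` integer_points) ->
  (forall x, (P `&` integer_points) x ->
    Pr (random_vector X @^-1` [set x]) = c%:E) ->
  Pr (random_vector X @^-1` P) =
    (#|` fset_set (P `&` integer_points)|%fset%:R * c)%:E.
Proof.
move=> P0 finS PrS.
have -> : random_vector X @^-1` P =
    \bigcup_(x in P `&` integer_points) (random_vector X @^-1` [set x]).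
  apply/seteqP; split => w /=.
    move=> wP; exists (random_vector X w) => //; split => // j.
    by rewrite mxE intr_nat.
  by move=> [x [xP _] /= ->].
rewrite measure_fin_bigcup//.
- rewrite fsbig_finite//= big_seq_cond (eq_bigr (fun=> c%:E)); last first.
    by move=> x; rewrite andbT in_fset_set// inE => /PrS.
  rewrite -big_seq_cond sumEFin big_const_seq iter_addr_0 count_predT.
  by rewrite mulr_natl.
- by move=> x y _ _ [w [/= <- <-]].
- move=> x [xP xZ]; rewrite (nonneg_integer_pointE (P0 _ xP) xZ).
  exact: measurable_random_vector.
Qed.

End law.
End lattice_points.

Theorem theorem3p1 (R : realType) (n : nat) (L P : set 'rV[R]_n)
    (hL : affine_subspace L) (hP : P = L `&` orthant)
    (hbounded : bounded_set P)
    (hpos : exists y, P y /\ forall j, 0 < y 0 j) :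
  strictly_concave_on orthant (@entropy R n) /\
  exists z : 'rV[R]_n,
    [/\ is_maximizer entropy P z,
        forall z', is_maximizer entropy P z' -> z' = z,
        forall j, 0 < z 0 j
      & forall (d : measure_display) (T : measurableType d)
          (Pr : probability T R) (X : 'I_n -> {RV Pr >-> nat}),
          independent_rvs X ->
          (forall j, geometric_rv (X j)) ->
          (forall j, 'E_Pr[fun w => (X j w)%:R] = (z 0 j)%:E)%E ->
          [/\ forall x, (P `&` integer_points) x ->
                Pr (random_vector X @^-1` [set x]) = (expR (- entropy z))%:E,
              finite_set (P `&` integer_points)
            & (#|` fset_set (P `&` integer_points)|%fset%:R)%:E =
                ((expR (entropy z))%:E * Pr (random_vector X @^-1` P))%E]].

Proof.
have P0 : P `<=` orthant by rewrite hP => x [].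
have [y [yP y0]] := hpos.
split; first exact: entropy_strictly_concave.
have [z zmax] := entropy_maximizer_exists hL hP hbounded (ex_intro _ y yP).
have z0 := entropy_maximizer_gt0 hL hP zmax yP y0.
exists z; split => //.
  by move=> z'; exact: (entropy_maximizer_unique hL hP zmax).
move=> d T Pr X indepX geomX EX.
have pmf x : (P `&` integer_points) x ->
    Pr (random_vector X @^-1` [set x]) = (expR (- entropy z))%:E.
  move=> [xP xZ]; have xE := nonneg_integer_pointE (P0 _ xP) xZ.
  rewrite {1}xE; apply: random_vector_pmf => //.
  (* The difference of the two sums is the orthogonality relation at [x], whose coordinates are
     their own truncations. *)
  apply/eqP; rewrite -subr_eq0 -sumrB.
  rewrite -[eqbRHS](entropy_maximizer_orthogonal hL hP zmax z0 xP).
  apply/eqP/eq_bigr => j _.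
  by rewrite {2}xE mxE mulrBl.
have finS := finite_integer_points P0 hbounded.
split => //.
rewrite (prob_random_vector_count P0 finS pmf) -EFinM; congr EFin.
by rewrite mulrCA -expRD subrr expR0 mulr1.
Qed.
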